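(* Let $q=2^e$ with $e\ge3$ odd, let $r\ge3$, and let $\sigma=2^{\frac{e+1}{2}}$. For $i=1,2$ let $\varepsilon_i\in\mathbb{F}_{q^2}\setminus\mathbb{F}_q$ satisfy $\varepsilon_i^2+\varepsilon_i+\delta_i=0$ with $\delta_i\in\mathbb{F}_q\setminus\{1\}$ and $\mathrm{Tr}_{q/2}(\delta_i)=1$. Then the linear codes $C(\mathcal{V}^r_{\varepsilon_1})$ and $C(\mathcal{V}^r_{\varepsilon_2})$ are equivalent.
   Context: For $\varepsilon\in\mathbb{F}_{q^2}\setminus\mathbb{F}_q$ with $\varepsilon^2+\varepsilon+\delta=0$, $\delta\in\mathbb{F}_q\setminus\{1\}$, $\mathrm{Tr}_{q/2}(\delta)=1$ ($\mathrm{Tr}_{q/2}$ the absolute trace of $\mathbb{F}_q$), put $$\Gamma_\varepsilon(x)=[x+(x^q+x)\varepsilon]^{\sigma+2}+(x^q+x)^\sigma+(x^{2q}+x^2)\varepsilon+x^{q+1}+x^2,$$ where in exponents $\sigma$ denotes the integer $2^{(e+1)/2}$. $\mathcal{V}^r_\varepsilon\subset\mathrm{PG}(r,q^2)$ is the set of $\mathbb{F}_{q^2}$-rational points of the projective hypersurface with affine equation $$x_r^q+x_r=\Gamma_\varepsilon(x_1)+\cdots+\Gamma_\varepsilon(x_{r-1}),$$ i.e. of the zero locus of the homogenization (with respect to $X_0$, $x_i=X_i/X_0$) of this polynomial equation, points on the hyperplane at infinity $X_0=0$ included. For a set $\Omega$ of points of $\mathrm{PG}(r,q^2)$, $C(\Omega)$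 is the linear code over $\mathbb{F}_{q^2}$ of length $|\Omega|$ whose generator matrix has as columns homogeneous coordinate vectors of the points of $\Omega$ (one column for each point). Two codes are equivalent if one can be obtained from the other by a combination of coordinate permutations and multiplications of coordinates by nonzero scalars. *)

(* Defs.v *)
From HB Require Import structures.
From mathcomp Require Import all_boot all_order all_algebra.
From mathcomp Require Import mpoly.

Set Implicit Arguments.
Unset Strict Implicit.
Unset Printing Implicit Defensive.

Import GRing.Theory.
Local Open Scope ring_scope.

(* The subfield F_q, for F a field of order q^2. *)
Definition subF (F : finFieldType) (q : nat) : {set F} :=
  [set x : F | x ^+ q == x].

(* The trace from F_(2^e) to F_2, with values in the ambient field F. *)
Definition absTr (F : finFieldType) (e : nat) (x : F) : F :=
  \sum_(i < e) x ^+ (2 ^ i).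

Definition admissible (F : finFieldType) (e : nat) (eps delta : F) : Prop :=
  [/\ eps \notin subF F (2 ^ e), eps ^+ 2 + eps + delta = 0,
      delta \in subF F (2 ^ e), delta != 1 & absTr e delta = 1].

(* Polynomials live in the ring of the homogeneous coordinates X_0, ..., X_r; *)
(* an affine polynomial is one in which 'X_ord0 does not occur, with 'X_i in  *)
(* the role of the affine coordinate x_i for 0 < i.                           *)

Definition Gamma (F : finFieldType) (n e : nat) (eps : F)
    (x : {mpoly F[n]}) : {mpoly F[n]} :=
  let q := (2 ^ e)%N in
  let sigma := (2 ^ (e.+1)./2)%N in
  (x + (x ^+ q + x) * eps%:MP) ^+ (sigma + 2) + (x ^+ q + x) ^+ sigma
  + (x ^+ (2 * q) + x ^+ 2) * eps%:MP + x ^+ (q + 1) + x ^+ 2.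

Definition affineBT (F : finFieldType) (e r : nat) (eps : F) :
    {mpoly F[r.+1]} :=
  ('X_ord_max ^+ (2 ^ e) + 'X_ord_max)
  - \sum_(1 <= i < r) Gamma e eps 'X_(inord i).

(* Homogenization with respect to X_0 of a polynomial not involving X_0;     *)
(* (msize p).-1 is the total degree of p.                                    *)
Definition homogenization (F : finFieldType) (r : nat)
    (p : {mpoly F[r.+1]}) : {mpoly F[r.+1]} :=
  \sum_(m <- msupp p)
     p@_m *: ('X_ord0 ^+ ((msize p).-1 - mdeg m) * 'X_[m]).

(* Points of PG(r, F) are the one-dimensional subspaces of F^(r+1). *)
Definition zero_locus (F : finFieldType) (r : nat) (h : {mpoly F[r.+1]}) :
    pred {vspace 'cV[F]_r.+1} :=
  [pred P : {vspace 'cV[F]_r.+1} | (\dim P == 1)%N &&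
    [forall v : 'cV[F]_r.+1, (v \in P) ==> (h.@[fun i => v i 0] == 0)]].

Definition BTvariety (F : finFieldType) (e r : nat) (eps : F) :
    pred {vspace 'cV[F]_r.+1} :=
  zero_locus (homogenization (affineBT e r eps)).
Arguments BTvariety {F} e r eps.

(* The columns of G are coordinate vectors of the points of Omega, each point *)
(* being represented exactly once; in particular n is the number of points.   *)
Definition point_matrix (F : finFieldType) (r n : nat)
    (Omega : pred {vspace 'cV[F]_r.+1}) (G : 'M[F]_(r.+1, n)) : Prop :=
  injective (fun j => <[col j G]>%VS) /\
  (forall P, P \in Omega <-> exists j, P = <[col j G]>%VS).

(* C is a code C(Omega), for some order of the points of Omega and some       *)
(* choice of their coordinate vectors.                                        *)
Definition is_code_of (F : finFieldType) (r n : nat)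
    (Omega : pred {vspace 'cV[F]_r.+1}) (C : {vspace 'rV[F]_n}) : Prop :=
  exists2 G : 'M[F]_(r.+1, n),
    point_matrix Omega G & C = <<[seq row i G | i : 'I_r.+1]>>%VS.

(* The bijection f forces n1 = n2. *)
Definition code_equiv (F : finFieldType) (n1 n2 : nat)
    (C1 : {vspace 'rV[F]_n1}) (C2 : {vspace 'rV[F]_n2}) : Prop :=
  exists (f : 'I_n2 -> 'I_n1) (a : 'I_n2 -> F),
    [/\ bijective f, forall j, a j != 0 &
        forall w : 'rV[F]_n2, w \in C2 <->
          exists2 u : 'rV[F]_n1, u \in C1 & w = \row_j (a j * u 0 (f j))].

(* Every set of points has a code, so quantifying over the codes of Omega is  *)
(* never vacuous.                                                             *)
Lemma is_code_of_exists (F : finFieldType) (r : nat)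
    (Omega : pred {vspace 'cV[F]_r.+1}) :
  (forall P, P \in Omega -> \dim P = 1%N) ->
  exists n (C : {vspace 'rV[F]_n}), is_code_of Omega C.
Proof.
move=> dimO.
pose s := undup [seq P <- [seq <[v]>%VS | v : 'cV[F]_r.+1] | Omega P].
pose G : 'M[F]_(r.+1, size s) := \matrix_(i, j) vpick (nth 0%VS s j) i 0.
have line P : \dim P = 1%N -> P = <[vpick P]>%VS.
  move=> dP; apply/esym/eqP; rewrite eqEdim -memvE memv_pick dP dim_vline.
  by rewrite vpick0 -dimv_eq0 dP.
have sO P : (P \in s) = (P \in Omega).
  rewrite mem_undup mem_filter; apply: andb_idr => OP.
  by apply/imageP; exists (vpick P) => //; apply: line; apply: dimO.
have colG j : <[col j G]>%VS = nth 0%VS s j.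
  have -> : col j G = vpick (nth 0%VS s j).
    by apply/colP=> i; rewrite !mxE.
  by rewrite -line // dimO // -sO mem_nth.
exists (size s), <<[seq row i G | i : 'I_r.+1]>>%VS, G => //; split.
  move=> j k /=; rewrite !colG => /eqP.
  by rewrite nth_uniq ?undup_uniq // => /eqP/val_inj.
move=> P; rewrite -sO; split=> [Ps | [j ->]]; last by rewrite colG mem_nth.
have lt : (index P s < size s)%N by rewrite index_mem.
by exists (Ordinal lt); rewrite colG /= nth_index.
Qed.

(* Main.v *)
Require Import Defs.
From mathcomp Require Import all_boot all_order all_algebra.
From mathcomp Require Import mpoly zify ring.
From mathcomp Require Import finfield.

Set Implicit Arguments.
Unset Strict Implicit.
Unset Printing Implicit Defensive.

Import GRing.Theory.
Local Open Scope ring_scope.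

(** Write q = 2^e, s = 2^((e+1)/2), so that x^(s^2) = x^2 on F_q.  The
generator matrix of C(Omega) has the coordinate vectors of the points of Omega
as columns, so an invertible linear map M carrying one point set onto another
turns a generator matrix into a generator matrix, up to reordering and
rescaling columns ([code_equiv_of_collineation]).  It is therefore enough to
find a collineation between the two varieties ([BTvariety_collineation]).

In the F_q-basis (1, eps) of F, write x = x0 + x1 eps.  Since
eps^q = eps + 1, one has x^q + x = x1 and x + (x^q + x) eps = x0, and Gamma_eps
becomes the Tits polynomial x0^(s+2) + x0 x1 + x1^s
([meval_Gamma], [BTform_coords]).  All dependence on eps is thus in the basis,
but the obvious change of basis is only F_q-linear.  The Tits polynomial has
further similarities: up to F_q-affine terms, it is multiplied by k^(s+2)
under (x0, x1) |-> (k x0 + a, k^(s+1) x1 + k a^s x0)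
([tits_form_similarity]).  From the basis (1, eps1) to the basis (1, eps2) such
a map is, translation aside, F-linear exactly when its value at eps1 is eps1
times its value at 1, that is when k^(s+1) eps2 = (k + k a^s eps2) eps1.  With
t = eps1 + eps2, which lies in F_q, this holds for k^s = delta1 / delta2 and
a^s = t / delta2; both equations are solvable because y |-> y^s permutes F_q
([BTform_similar]).  The remaining F_q-affine terms are traces to F_q of affine
functions of x over F, and the last coordinate, which occurs as
x_r^q + x_r, absorbs them.

At infinity only the leading form matters.  It is
eps^(s+2) (x_1^D + ... + x_(r-1)^D) with D = q(s+2), up to sign, so its zeros
do not depend on eps, and the collineation acts on x_1, ..., x_(r-1) there as a
scalar ([affineBT_at_infinity]). *)

(** * Codes of projectively equivalent point sets *)

Lemma vlines_eq_scale (F : fieldType) (V : vectType F) (u v : V) :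
  <[u]>%VS = <[v]>%VS -> exists2 a : F, a != 0 & u = a *: v.
Proof.
move=> uv; have [u0 | u_neq0] := eqVneq u 0.
  exists 1; rewrite ?oner_neq0 // scale1r u0.
  by apply/esym/eqP; rewrite -memv0 -[0%VS]/(<[0]>%VS) -u0 uv memv_line.
have /vlineP[a def_u] : u \in <[v]>%VS by rewrite -uv memv_line.
exists a => //; apply: contraNneq u_neq0 => a0.
by rewrite def_u a0 scale0r.
Qed.

Lemma mem_row_span (F : fieldType) (m n : nat) (G : 'M[F]_(m, n))
    (w : 'rV[F]_n) :
  w \in <<[seq row i G | i : 'I_m]>>%VS <-> exists y : 'rV[F]_m, w = y *m G.
Proof.
pose X := [tuple row i G | i < m].
have XE : [seq row i G | i : 'I_m] = X by [].
rewrite XE; split=> [/coord_span -> | [y ->]].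
  exists (\row_i coord X i w); rewrite mulmx_sum_row.
  by apply: eq_bigr => i _; rewrite mxE -tnth_nth tnth_mktuple.
rewrite mulmx_sum_row; apply: rpred_sum => i _; apply: rpredZ.
by apply: memv_span; apply: map_f; rewrite mem_enum.
Qed.

(** The images under M of the chosen columns of the first generator matrix are,
up to order and nonzero scalars a j, the columns of the second one, while M
itself only changes the basis of the row space. *)
Lemma code_equiv_of_collineation (F : finFieldType) (r n1 n2 : nat)
    (Omega1 Omega2 : pred {vspace 'cV[F]_r.+1}) (M : 'M[F]_r.+1)
    (C1 : {vspace 'rV[F]_n1}) (C2 : {vspace 'rV[F]_n2}) :
  M \in unitmx ->
  (forall v, (<[v]>%VS \in Omega1) = (<[M *m v]>%VS \in Omega2)) ->
  is_code_of Omega1 C1 -> is_code_of Omega2 C2 -> code_equiv C1 C2.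
Proof.
move=> Mu MO [G1 [inj1 O1] ->] [G2 [inj2 O2] ->].
have ex_f j : exists i : 'I_n1, <[invmx M *m col j G2]>%VS = <[col i G1]>%VS.
  by apply/O1; rewrite MO mulKVmx //; apply/O2; exists j.
have ex_g i : exists j : 'I_n2, <[M *m col i G1]>%VS = <[col j G2]>%VS.
  by apply/O2; rewrite -MO; apply/O1; exists i.
have line_mul (A : 'M[F]_r.+1) (u v : 'cV[F]_r.+1) :
    <[u]>%VS = <[v]>%VS -> <[A *m u]>%VS = <[A *m v]>%VS.
  move=> /vlines_eq_scale[a a0 ->]; rewrite -scalemxAr.
  apply/eqP; rewrite eqEsubv -!memvE memvZ ?memv_line //=.
  by rewrite -{1}(scalerK a0 (A *m v)) memvZ ?memv_line.
have [f fE] := fin_all_exists ex_f; have [g gE] := fin_all_exists ex_g.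
have fK : cancel f g.
  by move=> j; apply: inj2 => /=; rewrite -gE -(line_mul M _ _ (fE j)) mulKVmx.
have gK : cancel g f.
  by move=> i; apply: inj1 => /=; rewrite -fE -(line_mul _ _ _ (gE i)) mulKmx.
have ex_a j : exists a : F, a != 0 /\ col j G2 = a *: (M *m col (f j) G1).
  have /(line_mul M) := fE j; rewrite mulKVmx // => /vlines_eq_scale[a a0 ->].
  by exists a.
have [a aE] := fin_all_exists ex_a.
have entryE (y : 'rV[F]_r.+1) j : (y *m G2) 0 j = a j * (y *m M *m G1) 0 (f j).
  have entry m n (A : 'M[F]_(m, n)) k (x : 'rV_m) :
      (x *m A) 0 k = (x *m col k A) 0 0.
    by rewrite colE mulmxA -colE [RHS]mxE.
  by rewrite entry (proj2 (aE j)) -scalemxAr mxE [in RHS]entry mulmxA.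
exists f, a; split=> [|j|w]; first by exists g.
  exact: (proj1 (aE j)).
split=> [/mem_row_span[y ->] | [u /mem_row_span[y ->] ->]].
  exists (y *m M *m G1); first by apply/mem_row_span; exists (y *m M).
  by apply/rowP=> j; rewrite [RHS]mxE entryE.
apply/mem_row_span; exists (y *m invmx M); apply/rowP=> j.
by rewrite [LHS]mxE entryE mulmxKV.
Qed.

(** * Homogenization and leading forms *)

Lemma homogenization_at_affine (F : finFieldType) (r : nat)
    (p : {mpoly F[r.+1]}) (v : 'I_r.+1 -> F) :
  v ord0 != 0 ->
  (homogenization p).@[v]
    = v ord0 ^+ (msize p).-1 * p.@[fun i => v i / v ord0].
Proof.
move=> v0; rewrite raddf_sum mevalE big_distrr /=.
apply: eq_big_seq => m pm.
have le_m : (mdeg m <= (msize p).-1)%N.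
  by have := msize_mdeg_lt pm; case: (msize p).
have -> : \prod_i (v i / v ord0) ^+ m i
    = (\prod_i v i ^+ m i) / v ord0 ^+ mdeg m.
  rewrite mdegE -prodrXr -prodf_div.
  by apply: eq_bigr => i _; rewrite expr_div_n.
rewrite mevalZ mevalM rmorphXn /= mevalXU mevalX expfB_cond ?(negPf v0) //.
by rewrite [RHS]mulrCA -[_ / _ * _]mulrA [_^-1 * _]mulrC.
Qed.

(** Only the monomials of top degree carry no power of X_0. *)
Lemma homogenization_at_infinity (F : finFieldType) (r : nat)
    (p : {mpoly F[r.+1]}) (v : 'I_r.+1 -> F) :
  v ord0 = 0 ->
  (homogenization p).@[v] = (pihomog mdeg (msize p).-1 p).@[v].
Proof.
move=> v0; rewrite pihomogE !raddf_sum /= [RHS]big_mkcond /=.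
apply: eq_big_seq => m pm.
have le_m : (mdeg m <= (msize p).-1)%N.
  by have := msize_mdeg_lt pm; case: (msize p).
rewrite !mevalZ mevalM rmorphXn /= mevalXU v0 expr0n subn_eq0 eqn_leq le_m /=.
by case: leqP => _; rewrite ?mul1r ?mul0r ?mulr0.
Qed.

Lemma pihomog_eq0 (R : nzRingType) (n d : nat) (p : {mpoly R[n]}) :
  (msize p <= d)%N -> pihomog mdeg d p = 0.
Proof.
move=> le_d; rewrite pihomogE big_seq_cond big_pred0 // => m.
apply/negP => /andP[/msize_mdeg_lt lt_m /eqP def_d].
by move: lt_m; rewrite def_d ltnNge le_d.
Qed.

Lemma leading_form (R : nzRingType) (n d : nat) (t l : {mpoly R[n]}) :
  t \is d.-homog -> t != 0 -> (msize l <= d)%N ->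
  msize (t + l) = d.+1 /\ pihomog mdeg d (t + l) = t.
Proof.
move=> homt t0 sl.
have top : pihomog mdeg d (t + l) = t.
  by rewrite pihomogD (pihomog_eq0 sl) addr0 pihomog_dE.
split=> //; apply/eqP; rewrite eqn_leq; apply/andP; split.
  apply: leq_trans (msizeD_le _ _) _; rewrite geq_max (leqW sl) andbT.
  rewrite msizeE; apply/bigmax_leqP_seq => m tm _.
  by move/dhomogP: homt => /(_ m tm) ->.
rewrite ltnNge; apply: contraNN t0 => /pihomog_eq0.
by rewrite top => ->.
Qed.

Lemma msize_monomial_le (R : nzRingType) (n k d : nat) (c : R) (i : 'I_n) :
  (k < d)%N -> (msize (c%:MP * 'X_i ^+ k) <= d)%N.
Proof.
move=> kd; rewrite mul_mpolyC mpolyXn; apply: leq_trans (msizeZ_le _ _) _.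
by rewrite msizeX mdegMn mdeg1 mul1n.
Qed.

(** * The Buekenhout-Tits form in coordinates *)

Lemma eq_of_addr0_pchar2 (R : nzRingType) (x y : R) :
  2%N \in [pchar R] -> x + y = 0 -> x = y.
Proof. by move=> ch2 /eqP; rewrite addr_eq0 oppr_pchar2 // => /eqP. Qed.

Lemma frobeniusD (R : comNzRingType) (n : nat) (x y : R) :
  2%N \in [pchar R] -> (x + y) ^+ (2 ^ n) = x ^+ (2 ^ n) + y ^+ (2 ^ n).
Proof. by move=> ch2; rewrite exprDn_pchar // pnatX pnatE // ch2. Qed.

(** The eps-coordinate of x in the F_q-basis (1, eps), which is the same for
every eps with eps^q = eps + 1; it is also the trace of x to F_q. *)
Definition coord1 (F : finFieldType) (e : nat) (x : F) : F := x ^+ (2 ^ e) + x.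

(** The polynomial whose graph is the affine part of the Tits ovoid. *)
Definition tits_form (F : finFieldType) (e : nat) (x0 x1 : F) : F :=
  x0 ^+ (2 ^ (e.+1)./2 + 2) + x0 * x1 + x1 ^+ (2 ^ (e.+1)./2).

(** Gamma_eps as a function on F, with values in F_q. *)
Definition BTform (F : finFieldType) (e : nat) (eps x : F) : F :=
  tits_form e (x + coord1 e x * eps) (coord1 e x).

(** The conjugate of eps is the other root of T^2 + T + delta. *)
Lemma admissible_conj (F : finFieldType) (e : nat) (eps delta : F) :
  2%N \in [pchar F] -> admissible e eps delta -> eps ^+ (2 ^ e) = eps + 1.
Proof.
move=> ch2 [epsq eps_eq delq _ _].
have two0 : 2%:R = 0 :> F := pcharf0 ch2.
move: epsq delq; rewrite !inE => epsq /eqP delq.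
have conj_eq : (eps ^+ (2 ^ e)) ^+ 2 + eps ^+ (2 ^ e) + delta = 0.
  rewrite -[X in _ + X]delq exprAC -!frobeniusD // eps_eq expr0n expn_eq0.
  by [].
have : (eps ^+ (2 ^ e) - eps) * (eps ^+ (2 ^ e) - (eps + 1)) = 0.
  move: eps_eq conj_eq; set y := _ ^+ (2 ^ e) => h1 h2.
  have -> : (y - eps) * (y - (eps + 1))
    = (y ^+ 2 + y + delta) - (eps ^+ 2 + eps + delta).
    by rewrite !(oppr_pchar2 ch2); ring: two0.
  by rewrite h1 h2 subrr.
move/eqP; rewrite mulf_eq0 !subr_eq0 (negPf epsq) /=.
by move/eqP.
Qed.

Lemma coord1_coords (F : finFieldType) (e : nat) (eps delta x0 x1 : F) :
  2%N \in [pchar F] -> admissible e eps delta ->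
  x0 ^+ (2 ^ e) = x0 -> x1 ^+ (2 ^ e) = x1 -> coord1 e (x0 + x1 * eps) = x1.
Proof.
move=> ch2 adm h0 h1.
have two0 : 2%:R = 0 :> F := pcharf0 ch2.
rewrite /coord1 frobeniusD // exprMn (admissible_conj ch2 adm) h0 h1.
by ring: two0.
Qed.

Lemma BTform_coords (F : finFieldType) (e : nat) (eps delta x0 x1 : F) :
  2%N \in [pchar F] -> admissible e eps delta ->
  x0 ^+ (2 ^ e) = x0 -> x1 ^+ (2 ^ e) = x1 ->
  BTform e eps (x0 + x1 * eps) = tits_form e x0 x1.
Proof.
move=> ch2 adm h0 h1.
have two0 : 2%:R = 0 :> F := pcharf0 ch2.
rewrite /BTform (coord1_coords ch2 adm) //; congr tits_form.
by ring: two0.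
Qed.

Lemma coords_exist (F : finFieldType) (e : nat) (eps delta x : F) :
  2%N \in [pchar F] -> #|F| = ((2 ^ e) ^ 2)%N -> admissible e eps delta ->
  exists x0 x1 : F,
    [/\ x0 ^+ (2 ^ e) = x0, x1 ^+ (2 ^ e) = x1 & x = x0 + x1 * eps].
Proof.
move=> ch2 cardF adm.
have two0 : 2%:R = 0 :> F := pcharf0 ch2.
have xqq : (x ^+ (2 ^ e)) ^+ (2 ^ e) = x.
  by rewrite -exprM mulnn -cardF expf_card.
exists (x + coord1 e x * eps), (coord1 e x); split.
- rewrite frobeniusD // exprMn (admissible_conj ch2 adm) /coord1.
  rewrite frobeniusD // xqq.
  by ring: two0.
- by rewrite /coord1 frobeniusD // xqq addrC.
- by ring: two0.
Qed.

(** The last three terms of Gamma add up to x0 x1: they are x1^2 eps, the norm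
of x and x^2, in terms of x^q = x + x1 and x0 = x + x1 eps. *)
Lemma meval_Gamma (F : finFieldType) (e n : nat) (eps delta : F)
    (p : {mpoly F[n]}) (v : 'I_n -> F) :
  2%N \in [pchar F] -> #|F| = ((2 ^ e) ^ 2)%N -> admissible e eps delta ->
  (Gamma e eps p).@[v] = BTform e eps p.@[v].
Proof.
move=> ch2 cardF adm.
have two0 : 2%:R = 0 :> F := pcharf0 ch2.
have [x0 [x1 [h0 h1 px]]] := coords_exist p.@[v] ch2 cardF adm.
rewrite px (BTform_coords ch2 adm) // /Gamma /tits_form.
set s := (2 ^ (e.+1)./2)%N.
do 2!rewrite !(mevalD, mevalM, rmorphXn, mevalC) /=; rewrite px.
set x := x0 + x1 * eps.
have trx : x ^+ (2 ^ e) + x = x1 := coord1_coords ch2 adm h0 h1.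
have xq : x ^+ (2 ^ e) = x + x1 by rewrite -trx; ring: two0.
have x0E : x + x1 * eps = x0 by rewrite /x; ring: two0.
set q := (2 ^ e)%N in trx xq *.
rewrite (mulnC 2 q) (exprD _ q 1) (exprM _ q 2) expr1 trx xq x0E.
clearbody x; rewrite -[X in _ = _ + X * _ + _]x0E.
rewrite [RHS]addrAC -!addrA; do 2!congr (_ + _).
by apply: (eq_of_addr0_pchar2 ch2); ring: two0.
Qed.

(** * Similarity of the forms of two parameters *)

(** The exponent s^2 is 2 q. *)
Lemma sigma_sqr (F : finFieldType) (e : nat) (x : F) :
  odd e -> x ^+ (2 ^ e) = x ->
  (x ^+ (2 ^ (e.+1)./2)) ^+ (2 ^ (e.+1)./2) = x ^+ 2.
Proof.
move=> odde xq; rewrite -exprM -expnD.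
have -> : ((e.+1)./2 + (e.+1)./2 = e.+1)%N by lia.
by rewrite expnSr exprM xq.
Qed.

(** The product of the exponents 2^(e./2) and s is q, so raising to the power s
maps F_q onto itself. *)
Lemma sigma_root (F : finFieldType) (e : nat) (x : F) :
  odd e -> x ^+ (2 ^ e) = x ->
  (x ^+ (2 ^ e./2)) ^+ (2 ^ (e.+1)./2) = x.
Proof.
move=> odde xq; rewrite -exprM -expnD.
by have -> : (e./2 + (e.+1)./2 = e)%N by lia.
Qed.

(** The linear part (x0, x1) |-> (k x0, k^(s+1) x1 + u x0) creates the extra
terms k u x0^2 and u^s x0^s; the translation of x0 by a creates
k^2 a^s x0^2 and k^s a^2 x0^s, which cancel them when u = k a^s. *)
Lemma tits_form_similarity (F : finFieldType) (e : nat) (k a x0 x1 : F) :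
  2%N \in [pchar F] -> odd e ->
  k ^+ (2 ^ e) = k -> a ^+ (2 ^ e) = a ->
  let s := (2 ^ (e.+1)./2)%N in
  let u := k * a ^+ s in
  tits_form e (k * x0 + a) (k * k ^+ s * x1 + u * x0)
    = k ^+ (s + 2) * tits_form e x0 x1
      + a * (k * k ^+ s * x1 + u * x0) + a ^+ (s + 2).
Proof.
move=> ch2 odde kq aq s u; rewrite /tits_form -/s.
have frob_s (x y : F) : (x + y) ^+ s = x ^+ s + y ^+ s by exact: frobeniusD.
have as2 : (a ^+ s) ^+ s = a ^+ 2 by exact: sigma_sqr.
have ks2 : (k ^+ s) ^+ s = k ^+ 2 by exact: sigma_sqr.
rewrite /u !exprD !frob_s !exprMn as2 ks2.
have two0 := pcharf0 ch2.
by apply: subr0_eq; ring: two0.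
Qed.

(** With k^s = delta1 / delta2 and a^s = t / delta2, where t = eps1 + eps2, the
map of [tits_form_similarity] from the basis (1, eps1) to the basis (1, eps2)
is multiplication by l = k + k a^s eps2 followed by translation by a. *)
Lemma BTform_similar (F : finFieldType) (e : nat)
    (eps1 eps2 delta1 delta2 : F) :
  odd e -> 2%N \in [pchar F] -> #|F| = ((2 ^ e) ^ 2)%N ->
  admissible e eps1 delta1 -> admissible e eps2 delta2 ->
  exists l a c d b : F,
    [/\ l != 0, c != 0, c ^+ (2 ^ e) = c &
      forall x, BTform e eps2 (l * x + a)
        = c * BTform e eps1 x + coord1 e (d * x + b)].
Proof.
move=> odde ch2 cardF adm1 adm2.
set q := (2 ^ e)%N; set s := (2 ^ (e.+1)./2)%N.
have two0 : 2%:R = 0 :> F := pcharf0 ch2.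
have frob_q (x y : F) : (x + y) ^+ q = x ^+ q + y ^+ q by exact: frobeniusD.
have nz_delta (eps delta : F) : admissible e eps delta -> delta != 0.
  case=> [_ _ _ _ tr]; apply/eqP => d0; move: tr; rewrite d0 /absTr big1.
    by move/eqP; rewrite eq_sym oner_eq0.
  by move=> i _; rewrite expr0n expn_eq0.
have d1_0 := nz_delta _ _ adm1; have d2_0 := nz_delta _ _ adm2.
have e1q : eps1 ^+ q = eps1 + 1 := admissible_conj ch2 adm1.
have e2q : eps2 ^+ q = eps2 + 1 := admissible_conj ch2 adm2.
have [/= ne1 def_d1 d1q _ _] := adm1; have [/= ne2 def_d2 d2q _ _] := adm2.
move: d1q d2q; rewrite !inE -/q => /eqP d1q /eqP d2q.
pose t := eps1 + eps2.
have tq : t ^+ q = t by rewrite frob_q e1q e2q /t; ring: two0.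
pose k := (delta1 / delta2) ^+ (2 ^ e./2).
pose a := (t / delta2) ^+ (2 ^ e./2).
have divq x y : x ^+ q = x -> y ^+ q = y -> (x / y) ^+ q = x / y :> F.
  by move=> xq yq; rewrite expr_div_n xq yq.
have powq n x : x ^+ q = x -> (x ^+ n) ^+ q = x ^+ n :> F.
  by move=> xq; rewrite exprAC xq.
have kq : k ^+ q = k by apply/powq/divq.
have aq : a ^+ q = a by apply/powq/divq.
have ks : k ^+ s = delta1 / delta2 by apply/sigma_root/divq.
have as_ : a ^+ s = t / delta2 by apply/sigma_root/divq.
have k0 : k != 0 by rewrite expf_neq0 // mulf_neq0 ?invr_eq0.
pose u := k * a ^+ s.
have uq : u ^+ q = u by rewrite exprMn kq powq.
pose l := k + u * eps2.
(* If l = 0, then u is nonzero, as k is, and eps2 = k / u would lie in F_q. *)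
have l0 : l != 0.
  apply: contraNneq ne2 => l0; have [u0 | u_0] := eqVneq u 0.
    by move: k0; rewrite -[k](addrK (u * eps2)) -/l l0 u0 mul0r subrr eqxx.
  have -> : eps2 = k / u.
    by apply: (mulfI u_0); rewrite mulrCA divff // mulr1; apply/esym/eqP;
      rewrite -subr_eq0 oppr_pchar2 // -/l l0.
  by rewrite inE -/q; apply/eqP/divq.
have delta_eps (eps delta : F) : eps ^+ 2 + eps + delta = 0 ->
    delta = eps ^+ 2 + eps.
  by move/eqP; rewrite addr_eq0 oppr_pchar2 // eq_sym => /eqP.
(* This identity is what makes the map on coordinates F-linear. *)
have l_eps1 : l * eps1 = k * k ^+ s * eps2.
  have key : (delta2 + t * eps2) * eps1 = delta1 * eps2.
    rewrite (delta_eps _ _ def_d1) (delta_eps _ _ def_d2) /t.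
    by apply: subr0_eq; ring: two0.
  have -> : l * eps1 = k / delta2 * ((delta2 + t * eps2) * eps1).
    by rewrite /l /u as_; field.
  by rewrite key ks; field.
(* The trace of d x, for d = d0 + d1 eps1, is d1 x0 + (d0 + d1) x1, and it has
   to equal the linear term a (k^(s+1) x1 + u x0) of the similarity; the trace
   of b0 eps2 is the constant term b0. *)
pose d0 := a * (k * k ^+ s) + a * u; pose d1 := a * u.
pose b0 := a ^+ (s + 2).
exists l, a, (k ^+ (s + 2)), (d0 + d1 * eps1), (b0 * eps2).
split=> // [||x]; first by rewrite expf_neq0.
  exact: powq.
have [x0 [x1 [x0q x1q ->]]] := coords_exist x ch2 cardF adm1.
have -> : l * (x0 + x1 * eps1) + a
    = (k * x0 + a) + (k * k ^+ s * x1 + u * x0) * eps2.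
  rewrite mulrDr [l * (x1 * _)]mulrCA l_eps1 /l.
  by ring.
have mulq y z : y ^+ q = y -> z ^+ q = z -> (y * z) ^+ q = y * z :> F.
  by move=> yq zq; rewrite exprMn yq zq.
have addq y z : y ^+ q = y -> z ^+ q = z -> (y + z) ^+ q = y + z :> F.
  by move=> yq zq; rewrite frob_q yq zq.
rewrite (BTform_coords ch2 adm2); [|by auto..].
rewrite (tits_form_similarity _ _ ch2 odde kq aq) -/s -/u.
rewrite (BTform_coords ch2 adm1) // -addrA; congr (_ + _).
have d0q : d0 ^+ q = d0 by rewrite /d0; auto.
have d1q' : d1 ^+ q = d1 by rewrite /d1; auto.
have -> : (d0 + d1 * eps1) * (x0 + x1 * eps1)
    = (d0 * x0 + d1 * x1 * delta1) + (d0 * x1 + d1 * x0 + d1 * x1) * eps1.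
  apply: (eq_of_addr0_pchar2 ch2); rewrite (delta_eps _ _ def_d1).
  by ring: two0.
have coord1D y z : coord1 e (y + z) = coord1 e y + coord1 e z :> F.
  by rewrite /coord1 frobeniusD // addrACA.
rewrite coord1D (coord1_coords ch2 adm1); [|by auto..].
have -> : coord1 e (b0 * eps2) = b0.
  rewrite -[b0 * _]add0r (coord1_coords ch2 adm2) // ?expr0n ?expn_eq0 //.
  exact: powq.
rewrite /b0; congr (_ + _); apply: (eq_of_addr0_pchar2 ch2); rewrite /d0 /d1.
by move: (a) (u) (k * k ^+ s) => y z w; ring: two0.
Qed.

(** * Points at infinity *)

(** The Frobenius powers split (eps X^q + (1 + eps) X)^(s + 2) into four
monomials, and eps^(s + 2) X^(q (s + 2)) is the only term of degree q (s + 2)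
in Gamma. *)
Lemma Gamma_leading_term (F : finFieldType) (n e : nat) (eps : F) (i : 'I_n) :
  2%N \in [pchar F] -> (0 < e)%N ->
  let d := (2 ^ e * (2 ^ (e.+1)./2 + 2))%N in
  exists2 l : {mpoly F[n]}, (msize l <= d)%N &
    Gamma e eps 'X_i
      = (eps ^+ (2 ^ (e.+1)./2 + 2))%:MP * 'X_i ^+ d + l.
Proof.
move=> ch2 e0 /=; set q := (2 ^ e)%N; set s := (2 ^ _)%N.
have ch2m : 2%N \in [pchar {mpoly F[n]}].
  exact: (rmorph_pchar (@mpolyC n F)).
have two0 : 2%:R = 0 :> {mpoly F[n]} := pcharf0 ch2m.
have q1 : (1 < q)%N by rewrite -{1}(expn0 2) ltn_exp2l.
have s0 : (0 < s)%N by rewrite expn_gt0.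
have frob_s (x y : {mpoly F[n]}) : (x + y) ^+ s = x ^+ s + y ^+ s.
  exact: frobeniusD.
pose mon (c : F) k : {mpoly F[n]} := c%:MP * 'X_i ^+ k.
exists (mon (eps ^+ s * (1 + eps) ^+ 2) (q * s + 2)%N
  + mon ((1 + eps) ^+ s * eps ^+ 2) (s + q * 2)%N
  + mon ((1 + eps) ^+ s * (1 + eps) ^+ 2) (s + 2)%N
  + mon 1 (q * s)%N + mon 1 s + mon eps (q * 2)%N + mon eps 2
  + mon 1 (q + 1)%N + mon 1 2).
  do ?[apply: leq_trans (msizeD_le _ _) _; rewrite geq_max; apply/andP; split];
    apply: msize_monomial_le; nia.
rewrite /Gamma -/q -/s /mon (mulnC 2 q).
have -> : 'X_i + ('X_i ^+ q + 'X_i) * eps%:MP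
    = eps%:MP * 'X_i ^+ q + (1 + eps)%:MP * 'X_i :> {mpoly F[n]}.
  by rewrite mpolyCD mpolyC1; ring.
rewrite !exprD !frob_s !exprMn_comm; try exact: mulrC.
rewrite mulnDr !exprD !exprM !mpolyCM !rmorphXn /= !expr1 mpolyCD mpolyC1.
by ring: two0.
Qed.

Lemma affineBT_at_infinity (F : finFieldType) (e r : nat) (eps : F)
    (v : 'I_r.+1 -> F) :
  2%N \in [pchar F] -> (0 < e)%N -> (1 < r)%N -> eps != 0 -> v ord0 = 0 ->
  let s := (2 ^ (e.+1)./2)%N in
  (homogenization (affineBT e r eps)).@[v]
    = - (eps ^+ (s + 2) * \sum_(1 <= i < r) v (inord i) ^+ (2 ^ e * (s + 2))).
Proof.
move=> ch2 e0 r1 eps0 v0 s; set d := (2 ^ e * (s + 2))%N.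
have [l sl GE] := fin_all_exists2
  (fun i : 'I_r.+1 => Gamma_leading_term eps i ch2 e0).
pose t : {mpoly F[r.+1]} :=
  - \sum_(1 <= i < r) (eps ^+ (s + 2))%:MP * 'X_(inord i) ^+ d.
pose low : {mpoly F[r.+1]} :=
  'X_ord_max ^+ (2 ^ e) + 'X_ord_max - \sum_(1 <= i < r) l (inord i).
have tE w : t.@[w] = - (eps ^+ (s + 2) * \sum_(1 <= i < r) w (inord i) ^+ d).
  rewrite mevalN; congr (- _); rewrite mulr_sumr raddf_sum /=.
  by apply: eq_bigr => i _; rewrite mevalM mevalC rmorphXn /= mevalXU.
have pE : affineBT e r eps = t + low.
  rewrite /affineBT (eq_bigr _ (fun i _ => GE (inord i))) big_split /=.
  by rewrite /t /low; ring.
have homt : t \is d.-homog.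
  rewrite rpredN; apply: rpred_sum => i _.
  by rewrite mul_mpolyC rpredZ // mpolyXn dhomogX /= mdegMn mdeg1 mul1n.
have t0 : t != 0.
  (* The form is nonzero at the first unit vector. *)
  have : t.@[fun i => (i == inord 1)%:R] != 0.
    rewrite tE oppr_eq0 big_ltn // eqxx expr1n big_nat big1 ?addr0.
      by rewrite mulr1 expf_neq0.
    move=> i /andP[i1 ir]; rewrite -val_eqE /= !inordK ?ltnS //; try lia.
    by rewrite gtn_eqF // expr0n gtn_eqF // muln_gt0 expn_gt0 addn2.
  by apply: contraNneq => ->; rewrite meval0.
have q1 : (1 < 2 ^ e)%N by rewrite -{1}(expn0 2) ltn_exp2l.
have slow : (msize low <= d)%N.
  have lowX k : (k < d)%N ->
      (msize ('X_(@ord_max r) ^+ k : {mpoly F[r.+1]}) <= d)%N.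
    by move=> kd; rewrite -(mul1r (_ ^+ k)) -mpolyC1 msize_monomial_le.
  apply: leq_trans (msizeD_le _ _) _; rewrite geq_max; apply/andP; split.
    apply: leq_trans (msizeD_le _ _) _; rewrite geq_max -{2}(expr1 'X_ord_max).
    by rewrite !lowX // /d; nia.
  rewrite mmeasureN; apply: leq_trans (mmeasure_sum _ _ _ _) _.
  by elim/big_rec: _ => // i n _; rewrite geq_max sl.
have [sp top] := leading_form homt t0 slow.
by rewrite homogenization_at_infinity // pE sp /= top tE.
Qed.

(** * The collineation between the varieties *)

(** The affine map sending x_i to l x_i + a for 0 < i < r and x_r to
c x_r + sum_i (d x_i + b). *)
Definition collineation (F : finFieldType) (r : nat) (l a c d b : F) :
    'M[F]_r.+1 :=
  \matrix_(i, j)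
    if i == ord0 then (j == ord0)%:R
    else if i == ord_max then
      c * (j == ord_max)%:R
      + \sum_(1 <= k < r) (d * (j == inord k)%:R + b * (j == ord0)%:R)
    else l * (j == i)%:R + a * (j == ord0)%:R.

Lemma collineation_mul (F : finFieldType) (r : nat) (l a c d b : F)
    (v : 'cV[F]_r.+1) (i : 'I_r.+1) :
  (collineation r l a c d b *m v) i 0 =
    if i == ord0 then v ord0 0
    else if i == ord_max then
      c * v ord_max 0 + \sum_(1 <= k < r) (d * v (inord k) 0 + b * v ord0 0)
    else l * v i 0 + a * v ord0 0.
Proof.
have delta k : \sum_j (j == k)%:R * v j 0 = v k 0.
  rewrite (bigD1 k) //= eqxx mul1r big1 ?addr0 // => j /negPf ->.
  by rewrite mul0r.
rewrite mxE; under eq_bigr do rewrite mxE.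
case: ifP => _; first exact: delta.
case: ifP => _; last first.
  under eq_bigr do rewrite mulrDl -!mulrA.
  by rewrite big_split /= -!mulr_sumr !delta.
under eq_bigr do rewrite mulrDl mulr_suml -mulrA.
rewrite big_split /= -mulr_sumr delta exchange_big /=; congr (_ + _).
apply: eq_bigr => k _; under eq_bigr do rewrite mulrDl -!mulrA.
by rewrite big_split /= -!mulr_sumr !delta.
Qed.

(** The matrix is lower triangular, with 1, l, ..., l, c on the diagonal. *)
Lemma collineation_unit (F : finFieldType) (r : nat) (l a c d b : F) :
  l != 0 -> c != 0 -> collineation r l a c d b \in unitmx.
Proof.
move=> l0 c0.
have trig : is_trig_mx (collineation r l a c d b).
  apply/is_trig_mxP => i j ij; rewrite mxE.
  have j0 : (j == ord0) = false by rewrite -val_eqE /=; lia.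
  have ji : (j == i) = false by rewrite -val_eqE /=; lia.
  have im : (i == ord_max) = false.
    by have := ltn_ord j; rewrite -val_eqE /=; lia.
  by rewrite j0 ji im; case: ifP => _; rewrite ?mulr0 ?addr0.
rewrite unitmxE det_trig // unitfE; apply/prodf_neq0 => i _; rewrite mxE eqxx.
have [_|i0] := eqVneq i ord0; first exact: oner_neq0.
have [im|_] := eqVneq i ord_max; last by rewrite mulr1 mulr0 addr0.
rewrite mulr1 big_nat big1 ?addr0 // => k /andP[_ kr].
have -> : (i == inord k) = false by rewrite im -val_eqE /= inordK; lia.
by rewrite !mulr0 addr0.
Qed.

Lemma meval_affineBT (F : finFieldType) (e r : nat) (eps delta : F)
    (v : 'I_r.+1 -> F) :
  2%N \in [pchar F] -> #|F| = ((2 ^ e) ^ 2)%N -> admissible e eps delta ->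
  (affineBT e r eps).@[v]
    = coord1 e (v ord_max) - \sum_(1 <= i < r) BTform e eps (v (inord i)).
Proof.
move=> ch2 cardF adm.
rewrite mevalB mevalD rmorphXn /= mevalXU /coord1; congr (_ - _).
rewrite raddf_sum /=; apply: eq_bigr => i _.
by rewrite (meval_Gamma _ _ ch2 cardF adm) mevalXU.
Qed.

(** In the affine part, the traces of d x_i + b added to x_r^q + x_r cancel
those coming from the forms, leaving the first equation multiplied by c; at
infinity the leading form is multiplied by a nonzero constant. *)
Lemma BTvariety_collineation (F : finFieldType) (e r : nat)
    (eps1 eps2 delta1 delta2 : F) :
  (1 < r)%N -> odd e -> 2%N \in [pchar F] -> #|F| = ((2 ^ e) ^ 2)%N ->
  admissible e eps1 delta1 -> admissible e eps2 delta2 ->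
  exists2 M : 'M[F]_r.+1, M \in unitmx &
    forall v, (<[v]>%VS \in BTvariety e r eps1)
            = (<[M *m v]>%VS \in BTvariety e r eps2).
Proof.
move=> r1 odde ch2 cardF adm1 adm2.
have [l [a [c [d [b [l0 c0 cq sim]]]]]] :=
  BTform_similar odde ch2 cardF adm1 adm2.
pose M := collineation r l a c d b.
have Mu : M \in unitmx by apply: collineation_unit.
have e0 : (0 < e)%N by case: (e) odde.
have nz (eps delta : F) : admissible e eps delta -> eps != 0.
  case=> [neps _ _ _ _]; apply: contraNneq neps => ->.
  by rewrite inE expr0n expn_eq0.
have Minner (v : 'cV[F]_r.+1) i :
    (1 <= i < r)%N -> (M *m v) (inord i) 0 = l * v (inord i) 0 + a * v ord0 0.
  move=> i1r; rewrite collineation_mul -!val_eqE /= inordK; last lia.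
  by have [-> ->] : (i == 0)%N = false /\ (i == r)%N = false by lia.
have Mlast (v : 'cV[F]_r.+1) : (M *m v) ord_max 0
    = c * v ord_max 0 + \sum_(1 <= k < r) (d * v (inord k) 0 + b * v ord0 0).
  by rewrite collineation_mul eqxx -val_eqE /= gtn_eqF //; lia.
have M0 (v : 'cV[F]_r.+1) : (M *m v) ord0 0 = v ord0 0.
  by rewrite collineation_mul.
have zeros (v : 'cV[F]_r.+1) :
    ((homogenization (affineBT e r eps1)).@[fun i => v i 0] == 0)
    = ((homogenization (affineBT e r eps2)).@[fun i => (M *m v) i 0] == 0).
  have [v0|v0] := eqVneq (v ord0 0) 0.
    rewrite !affineBT_at_infinity ?M0 ?(nz _ _ adm1) ?(nz _ _ adm2) //.
    set D := (_ * _)%N; rewrite !oppr_eq0 !mulf_eq0 !expf_eq0.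
    rewrite (negPf (nz _ _ adm1)) (negPf (nz _ _ adm2)) !andbF /=.
    have -> : \sum_(1 <= i < r) (M *m v) (inord i) 0 ^+ D
        = l ^+ D * \sum_(1 <= i < r) v (inord i) 0 ^+ D.
      rewrite mulr_sumr !big_nat; apply: eq_bigr => i i1r.
      by rewrite Minner // v0 mulr0 addr0 exprMn.
    by rewrite mulf_eq0 expf_eq0 (negPf l0) andbF.
  rewrite !homogenization_at_affine ?M0 //.
  rewrite !mulf_eq0 !expf_eq0 (negPf v0) !andbF /=.
  rewrite (meval_affineBT _ ch2 cardF adm1) (meval_affineBT _ ch2 cardF adm2).
  have coord1D (x y : F) : coord1 e (x + y) = coord1 e x + coord1 e y.
    by rewrite /coord1 frobeniusD // addrACA.
  have coord1_sum (f : nat -> F) :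
      coord1 e (\sum_(1 <= k < r) f k) = \sum_(1 <= k < r) coord1 e (f k).
    apply: (big_morph (coord1 e) coord1D).
    by rewrite /coord1 expr0n expn_eq0 addr0.
  have coord1Z (x : F) : coord1 e (c * x) = c * coord1 e x.
    by rewrite /coord1 exprMn cq mulrDr.
  set x := fun i => v i 0 / v ord0 0.
  have -> : (M *m v) ord_max 0 / v ord0 0
      = c * x ord_max + \sum_(1 <= k < r) (d * x (inord k) + b).
    rewrite Mlast mulrDl -mulrA mulr_suml; congr (_ + _).
    by apply: eq_bigr => k _; rewrite mulrDl -mulrA mulfK.
  have -> : \sum_(1 <= i < r) BTform e eps2 ((M *m v) (inord i) 0 / v ord0 0)
      = c * \sum_(1 <= i < r) BTform e eps1 (x (inord i))
        + \sum_(1 <= i < r) coord1 e (d * x (inord i) + b).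
    rewrite mulr_sumr -big_split !big_nat; apply: eq_bigr => i i1r /=.
    by rewrite Minner // mulrDl -mulrA mulfK // sim.
  rewrite coord1D coord1_sum coord1Z.
  rewrite [X in _ = (_ - X == _)]addrC opprD addrA addrK -mulrBr.
  by rewrite mulf_eq0 (negPf c0).
exists M; first exact: Mu.
move=> v.
rewrite /BTvariety !inE !dim_vline.
have -> : (M *m v != 0) = (v != 0).
  by rewrite -[v == 0](inj_eq (can_inj (mulKmx Mu))) mulmx0.
congr andb; apply/forallP/forallP => H w; apply/implyP.
  move/vlineP=> [k ->]; rewrite scalemxAr -zeros.
  by apply: (implyP (H _)); rewrite memvZ ?memv_line.
move/vlineP=> [k ->]; rewrite zeros -scalemxAr.
by apply: (implyP (H _)); rewrite memvZ ?memv_line.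
Qed.

Theorem mainTheorem5 (e r : nat) (F : finFieldType)
    (eps1 eps2 delta1 delta2 : F) (n1 n2 : nat)
    (C1 : {vspace 'rV[F]_n1}) (C2 : {vspace 'rV[F]_n2}) :
  (3 <= e)%N -> odd e -> (3 <= r)%N ->
  #|F| = ((2 ^ e) ^ 2)%N ->
  admissible e eps1 delta1 -> admissible e eps2 delta2 ->
  is_code_of (BTvariety e r eps1) C1 ->
  is_code_of (BTvariety e r eps2) C2 ->
  code_equiv C1 C2.
Proof.
move=> _ odde r3 cardF adm1 adm2.
have ch2 : 2%N \in [pchar F].
  by apply: (@card_finPcharP F 2 (e * 2)); rewrite ?expnM.
have [M Mu MV] := BTvariety_collineation (ltnW r3) odde ch2 cardF adm1 adm2.
exact: code_equiv_of_collineation Mu MV.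
Qed.
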